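(* Let $d$ be a positive integer. The following two statements are equivalent. (i) There is a function $\varepsilon:\mathbb{N}\to\mathbb{R}$ with $\varepsilon(N)\to0$ as $N\to\infty$ such that for every $d$--regular bipartite graph $G$ on $v(G)=2n$ vertices and every integer $0\leq k\leq n$, $$\frac{\ln m_k(G)}{v(G)}\geq \mathcal{G}_d(p)-\varepsilon(v(G)),\qquad p=\frac{k}{n}.$$ (ii) For every $d$--regular bipartite graph $G$ and every $0\leq p\leq 1$, $$\lambda_G(p)\geq\mathcal{G}_d(p).$$
   Context: $m_k(G)$ is the number of matchings of size $k$ ($m_0=1$). $\mathcal{G}_d(p)=\frac{1}{2}\left(p\ln\frac{d}{p}+(d-p)\ln\left(1-\frac{p}{d}\right)-2(1-p)\ln(1-p)\right)$ for $0\leq p\leq1$, with $0\ln(\cdot)=0$. For a finite graph $G$ let $M(G,t)=\sum_km_k(G)t^k$ and $p(G,t)=\frac{2t\,\frac{d}{dt}M(G,t)}{v(G)M(G,t)}$ ($t\geq0$); with $\nu(G)$ the maximum matching size and $p^*=2\nu(G)/v(G)$, $p(G,\cdot)$ is a strictly increasing bijection $[0,\infty)\to[0,p^* )$ with inverse $t(G,p)$. The entropy function is $\lambda_G(p)=\frac{\ln M(G,t(G,p))}{v(G)}-\frac12p\ln t(G,p)$ for $0\leq p<p^*$ (value $0$ at $p=0$), $\lambda_G(p^* )=\lim_{p\nearrow p^*}\lambda_G(p)$, and $\lambda_G(p)=0$ for $p>p^*$. *)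

(* Defs.v *)
From HB Require Import structures.
From mathcomp Require Import all_boot all_order all_algebra.
From mathcomp Require Import all_classical all_reals all_analysis.
Set Implicit Arguments. Unset Strict Implicit. Unset Printing Implicit Defensive.
Import Order.TTheory GRing.Theory Num.Theory.
Import numFieldNormedType.Exports.
Local Open Scope ring_scope.

Definition simple_graph (T : finType) (e : rel T) : Prop :=
  symmetric e /\ irreflexive e.

Definition regular (T : finType) (e : rel T) (d : nat) : Prop :=
  forall x : T, #|[set y | e x y]| = d.

Definition bipartite (T : finType) (e : rel T) : Prop :=
  exists A : {set T}, forall x y, e x y -> (x \in A) != (y \in A).

Definition edges (T : finType) (e : rel T) : {set {set T}} :=
  [set E : {set T} | [exists x, exists y, e x y && (E == [set x; y])]].

Definition matching (T : finType) (e : rel T) (S : {set {set T}}) : bool :=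
  (S \subset edges e) &&
  [forall E1 in S, forall E2 in S, (E1 != E2) ==> [disjoint E1 & E2]].

Definition mk (T : finType) (e : rel T) (k : nat) : nat :=
  #|[set S : {set {set T}} | matching e S && (#|S| == k)]|.

Definition nu (T : finType) (e : rel T) : nat :=
  \max_(S : {set {set T}} | matching e S) #|S|.

Definition mul_ln (R : realType) (a b : R) : R := if a == 0 then 0 else a * ln b.

Definition Gd (R : realType) (d : nat) (p : R) : R :=
  2^-1 * (mul_ln p (d%:R / p) + mul_ln (d%:R - p) (1 - p / d%:R)
          - 2 * mul_ln (1 - p) (1 - p)).

Section Entropy.
Variables (R : realType) (T : finType) (e : rel T).

Definition Mpoly : {poly R} := \poly_(k < #|T|.+1) (mk e k)%:R.

Definition vG : R := #|T|%:R.

Definition pG (t : R) : R := 2 * t * (Mpoly^`()).[t] / (vG * Mpoly.[t]).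

(* t(G,p): the t >= 0 with p(G,t) = p (unique for 0 <= p < pstar) *)
Definition tG (p : R) : R := xget 0 [set t : R | 0 <= t /\ pG t = p].

Definition pstar : R := 2 * (nu e)%:R / vG.

Definition lambda0 (p : R) : R :=
  if p == 0 then 0 else ln (Mpoly.[tG p]) / vG - 2^-1 * p * ln (tG p).

Local Open Scope classical_set_scope.
Definition lambdaG (p : R) : R :=
  if p < pstar then lambda0 p
  else if p == pstar then lim (lambda0 x @[x --> at_left pstar])
  else 0.
End Entropy.

(* Main.v *)
(* For fixed [t > 0] put [f_t(p) = ln M(G,t) / v(G) - (p/2) ln t].  By Jensen's
   inequality [lambda_G(p)] is the infimum of [f_t(p)] over [t > 0] for every [p <= p*].

   (i) => (ii): the generating function of [N] disjoint copies of [G] is at most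
   [M(G,t)^N], so [ln m_k / v] for the copies is at most [max(0, f_t(p))] at the
   corresponding density [p].  Letting [N] grow with densities tending to a given [p],
   (i) yields [G_d(p) <= max(0, f_t(p))] for all [t].  The maximum is [f_t(p)] if
   [p <= p*], and it is [0] for large [t] if [p > p*].

   (ii) => (i): matching numbers are log-concave (Heilmann-Lieb), so for
   [t = m_(k-1) / m_k] the largest of the [v + 1] terms of [M(G,t)] is [m_k t^k], and
   [lambda_G(p) <= f_t(p) <= (ln m_k + ln (v + 1)) / v]. *)
Require Import Defs.
From mathcomp Require Import all_boot all_order all_algebra all_field.
From mathcomp Require Import ring lra zify.
Import Order.TTheory GRing.Theory Num.Theory.
Local Open Scope ring_scope.

Set Implicit Arguments. Unset Strict Implicit. Unset Printing Implicit Defensive.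

(** * Log-concavity of the matching numbers *)

Section Matchings.
Variables (T : finType) (e : rel T).
Hypothesis he : simple_graph e.
Implicit Types (S : {set {set T}}) (V : {set T}).

Lemma edgesP (E : {set T}) :
  reflect (exists x y, e x y /\ E = [set x; y]) (E \in edges e).
Proof.
rewrite inE; apply: (iffP existsP) => [[x /existsP[y /andP[exy /eqP ->]]]|].
  by exists x, y.
by move=> [x [y [exy ->]]]; exists x; apply/existsP; exists y; rewrite exy /=.
Qed.

Lemma matchingP S :
  reflect (S \subset edges e /\
           forall E1 E2 x, E1 \in S -> E2 \in S -> x \in E1 -> x \in E2 -> E1 = E2)
          (matching e S).
Proof.
apply: (iffP andP) => -[Se Sd]; split=> //.
  move=> E1 E2 x E1S E2S xE1 xE2; apply/eqP/negPn/negP => ne.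
  have /forall_inP/(_ E1 E1S)/forall_inP/(_ E2 E2S) := Sd.
  by rewrite ne /= disjoint_subset => /subsetP/(_ x xE1); rewrite inE xE2.
apply/forall_inP => E1 E1S; apply/forall_inP => E2 E2S; apply/implyP => ne.
rewrite disjoint_subset; apply/subsetP => x xE1; rewrite inE.
by apply: contra ne => xE2; apply/eqP; apply: (Sd _ _ x).
Qed.

Lemma matching_sub S S' : S' \subset S -> matching e S -> matching e S'.
Proof.
move=> /subsetP sS /matchingP[/subsetP Se Sd]; apply/matchingP; split.
  by apply/subsetP => E /sS/Se.
by move=> E1 E2 x /sS E1S /sS E2S; apply: Sd.
Qed.

Lemma card_matching_le S : matching e S -> (#|S| <= #|T|)%N.
Proof.
move=> /matchingP[/subsetP Se Sd].
have H E : E \in S -> exists x, x \in E.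
  by move=> /Se /edgesP[x [y [_ ->]]]; exists x; rewrite !inE eqxx.
case: (pickP (mem S)) => [E0 /= E0S|S0]; last by rewrite (eq_card0 S0).
have [x0 _] := H _ E0S.
pose f (E : {set T}) := odflt x0 [pick x in E].
have fP E : E \in S -> f E \in E.
  by move=> /H[x xE]; rewrite /f; case: pickP => [//|/(_ x)]; rewrite /= xE.
rewrite -(card_in_imset (f := f)); first exact: max_card.
move=> E1 E2 E1S E2S eqf.
by apply: (Sd _ _ _ E1S E2S (fP _ E1S)); rewrite eqf fP.
Qed.

Lemma matching0 : matching e set0.
Proof.
apply/matchingP; split; first exact: sub0set.
by move=> E1 E2 x; rewrite in_set0.
Qed.

Lemma matching_setU1 S (x u : T) : e x u -> matching e S ->
  x \notin cover S -> u \notin cover S -> matching e ([set x; u] |: S).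
Proof.
move=> exu /matchingP[Se Sd] /bigcupP xS /bigcupP uS; apply/matchingP; split.
  rewrite subUset Se andbT sub1set; apply/edgesP; by exists x, u.
have dis E z : E \in S -> z \in [set x; u] -> z \in E -> False.
  by move=> ES; rewrite !inE => /orP[]/eqP-> zE; [apply: xS|apply: uS]; exists E.
move=> E1 E2 z; rewrite !(inE, in_setU1) => /orP[/eqP->|E1S] /orP[/eqP->|E2S] // z1 z2.
- by case: (dis E2 z).
- by case: (dis E1 z).
- exact: (Sd _ _ z).
Qed.

(** * Matching generating functions and the vertex recursion *)

Section Weight.
Variable (K : comNzRingType).
Implicit Type t : K.

(** Confining matchings to a vertex set [V] of a fixed type keeps vertex deletion within one family.
    The ring is generic: zeros are studied over an algebraically closed field, estimates over the
    reals. *)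
Definition match_gf V t : K :=
  \sum_(S | matching e S && (cover S \subset V)) t ^+ #|S|.

Lemma match_gfE t : match_gf [set: T] t = \sum_(k < #|T|.+1) (mk e k)%:R * t ^+ k.
Proof.
rewrite /match_gf; under eq_bigl => S do rewrite subsetT andbT.
rewrite (partition_big (fun S => inord #|S| : 'I_#|T|.+1) xpredT) //=.
apply: eq_bigr => k _; rewrite /mk -sum1dep_card natr_sum mulr_suml.
apply: eq_big => [S|S]; last first.
  by case/andP=> mS /eqP <-; rewrite mul1r inordK // ltnS card_matching_le.
case mS: (matching e S) => //=.
by rewrite -val_eqE /= inordK // ltnS card_matching_le.
Qed.

(** A matching either misses [v], or consists of an edge [[set v; u]] and a matching that avoids
    both [v] and [u]. *)
Lemma match_gf_rec V v t : v \in V ->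
  match_gf V t = match_gf (V :\ v) t +
    \sum_(u in V | e v u) t * match_gf (V :\ v :\ u) t.
Proof.
have [esym eirr] := he.
move=> vV; rewrite {1}/match_gf (bigID (fun S => v \in cover S)) /= addrC; congr (_ + _).
  apply: eq_bigl => S; rewrite -andbA; congr (_ && _).
  by rewrite subsetD1.
(* [g S] is the partner of [v] in [S]; the default [v] arises only when [v] is uncovered. *)
pose g S := odflt v [pick u | [set v; u] \in S].
have gP S : matching e S -> v \in cover S -> [set v; g S] \in S /\ e v (g S).
  move=> mS /bigcupP[E ES vE]; have /matchingP[/subsetP Se Sd] := mS.
  have [x [y [exy EE]]] := edgesP _ (Se _ ES).
  rewrite /g; case: pickP => [u uS|nu] /=.
    split=> //; have [a [b [eab Eab]]] := edgesP _ (Se _ uS).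
    have : u \in [set a; b] by rewrite -Eab !inE eqxx orbT.
    have : v \in [set a; b] by rewrite -Eab !inE eqxx.
    have : a \in [set v; u] by rewrite Eab !inE eqxx.
    have : b \in [set v; u] by rewrite Eab !inE eqxx orbT.
    rewrite !inE => /orP[]/eqP eb /orP[]/eqP ea; subst a b.
    - by rewrite eirr in eab.
    - by rewrite esym.
    - by [].
    - by rewrite eirr in eab.
  have : v \in [set x; y] by rewrite -EE.
  rewrite !inE => /orP[]/eqP ev; subst v.
    by have := nu y; rewrite -EE ES.
  by have := nu x; rewrite setUC -EE ES.
have gU S u : matching e S -> [set v; u] \in S -> g S = u.
  move=> mS uS; have vS : v \in cover S.
    by apply/bigcupP; exists [set v; u] => //; rewrite !inE eqxx.
  have [gS evg] := gP _ mS vS; have /matchingP[/subsetP Se Sd] := mS.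
  have Eq : [set v; g S] = [set v; u].
    by apply: (Sd _ _ v) => //; rewrite !inE eqxx.
  have : g S \in [set v; u] by rewrite -Eq !inE eqxx orbT.
  rewrite !inE => /orP[]/eqP // gv.
  by rewrite gv eirr in evg.
rewrite (partition_big g (fun u => (u \in V) && e v u)) /=; last first.
  move=> S /andP[/andP[mS SV] vS]; have [gS ->] := gP _ mS vS; rewrite andbT.
  apply: (subsetP SV); apply/bigcupP; exists [set v; g S] => //.
  by rewrite !inE eqxx orbT.
apply: eq_bigr => u /andP[uV evu].
have uv : u != v by apply: contraTneq evu => ->; rewrite eirr.
rewrite /match_gf big_distrr /=.
have notin S' : cover S' \subset V :\ v :\ u -> v \notin cover S' /\ u \notin cover S'.
  by rewrite !subsetD1 => /andP[/andP[_ ->] ->].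
have notE S' : v \notin cover S' -> [set v; u] \notin S'.
  move=> vS; apply: contra vS => ES; apply/bigcupP; exists [set v; u] => //.
  by rewrite !inE eqxx.
rewrite (reindex_onto (fun S => [set v; u] |: S) (fun S => S :\ [set v; u])) /=; last first.
  move=> S /andP[/andP[/andP[mS SV] vS] /eqP gS]; apply: setD1K.
  by have [] := gP _ mS vS; rewrite gS.
apply: eq_big => [S|S].
  apply/idP/idP.
    move=> /andP[/andP[/andP[/andP[mS SV] vS] _] /eqP US].
    have ES : [set v; u] \notin S by rewrite -US !inE eqxx.
    have mS' : matching e S by apply: matching_sub mS; apply: subsetUr.
    rewrite mS' /=; apply/subsetP => x /bigcupP[E ES' xE].
    have xV : x \in V.
      apply: (subsetP SV); apply/bigcupP; exists E => //.
      by rewrite in_setU1 ES' orbT.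
    have /matchingP[_ Sd] := mS.
    have xx : x \notin [set v; u].
      apply: contra ES => xvu; suff <- : E = [set v; u] by [].
      by apply: (Sd _ _ x) => //; [rewrite in_setU1 ES' orbT | exact: setU11].
    by rewrite !inE in xx *; rewrite xV andbT; case: (x == v) (x == u) xx => [] [].
  move=> /andP[mS SV]; have [vS uS] := notin _ SV.
  have mU := matching_setU1 evu mS vS uS.
  rewrite mU setU1K ?notE // eqxx andbT.
  have -> : g ([set v; u] |: S) == u by apply/eqP; apply: gU; rewrite ?in_setU1 ?eqxx.
  rewrite andbT; apply/andP; split; last first.
    by apply/bigcupP; exists [set v; u]; rewrite ?in_setU1 ?inE ?eqxx.
  apply/subsetP => x /bigcupP[E]; rewrite in_setU1 => /orP[/eqP->|ES xE].
    by rewrite !inE => /orP[]/eqP->.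
  have : x \in cover S by apply/bigcupP; exists E.
  by move=> /(subsetP SV); rewrite !inE => /and3P[].
move=> /andP[_ /eqP US].
have ES : [set v; u] \notin S by rewrite -US !inE eqxx.
by rewrite cardsU1 ES add1n exprS.
Qed.

End Weight.

(** * Zeros of the generating function *)

Section HalfPlane.
Variable C : numClosedFieldType.

Lemma Re_inv_gt0 (z : C) : 0 < 'Re z -> 0 < 'Re z^-1.
Proof.
move=> z0; rewrite ReV divr_gt0 // exprn_gt0 // normr_gt0.
by apply: contraTneq z0 => ->; rewrite raddf0 ltxx.
Qed.

(* Along the recursion, [M V / (s M (V \ v)) = 1/s + \sum_u 1 / (M (V \ v) / (s M (V \ v \ u)))]
   stays in the open right half-plane. *)
Lemma match_gf_sqr_neq0 (s : C) V : 0 < 'Re s -> match_gf V (s ^+ 2) != 0.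
Proof.
move=> s0; have sN0 : s != 0 by apply: contraTneq s0 => ->; rewrite raddf0 ltxx.
pose M V := match_gf V (s ^+ 2); rewrite -/(M V).
(* The two claims feed each other: nonvanishing for smaller sets permits the divisions, and a ratio
   with positive real part forces [M V] to be nonzero. *)
suff H n : forall V, (#|V| = n)%N ->
    M V != 0 /\ forall v, v \in V -> 0 < 'Re (M V / (s * M (V :\ v))).
  by have [] := H _ V erefl.
elim: n => [|n IHn] {}V cV.
  split; last by move=> v; rewrite (cards0_eq cV) inE.
  rewrite (cards0_eq cV) /M /match_gf (big_pred1 set0) ?cards0 ?oner_eq0 // => S.
  rewrite /=; apply/idP/eqP => [/andP[mS S0]|->]; last first.
    by rewrite matching0 /cover big_set0 sub0set.
  apply/setP => E; rewrite in_set0; apply/negP => ES.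
  have /matchingP[/subsetP Se _] := mS.
  have [x [y [_ EE]]] := edgesP _ (Se _ ES).
  have : x \in cover S by apply/bigcupP; exists E => //; rewrite EE !inE eqxx.
  by move=> /(subsetP S0); rewrite inE.
have Mv v : v \in V -> 0 < 'Re (M V / (s * M (V :\ v))).
  move=> vV; have cVv : #|V :\ v| = n by have := cardsD1 v V; rewrite vV cV; case.
  have [Nv Rv] := IHn _ cVv.
  have -> : M V / (s * M (V :\ v)) =
      s^-1 + \sum_(u in V | e v u) (M (V :\ v) / (s * M (V :\ v :\ u)))^-1.
    rewrite {1}/M (match_gf_rec _ vV) -/(M _) mulrDl; congr (_ + _).
      by rewrite invfM mulrCA divff // mulr1.
    rewrite mulr_suml; apply: eq_bigr => u _; rewrite -/(M _).
    by rewrite invf_div expr2 invfM; field; rewrite sN0 Nv.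
  rewrite raddfD ltr_pwDl ?Re_inv_gt0 // raddf_sum sumr_ge0 // => u /andP[uV evu].
  apply/ltW/Re_inv_gt0/Rv; rewrite !inE uV andbT.
  by apply: contraTneq evu => ->; rewrite he.2.
split=> //.
have /card_gt0P[v vV] : (0 < #|V|)%N by rewrite cV.
have := Mv v vV; apply: contraTneq => ->.
by rewrite mul0r raddf0 ltxx.
Qed.

(** Neither square root of a zero lies in the open right half-plane, so both are purely imaginary
    and their square is nonpositive. *)
Lemma match_gf_root_le0 (z : C) V : match_gf V z = 0 -> z <= 0.
Proof.
move=> Mz; have zE := sqrtCK z; set s := sqrtC z in zE.
have := Creal_Re s; rewrite realE => /orP sR.
have Re0 : 'Re s = 0.
  apply/eqP/negPn/negP => ne.
  have [R0|R0] : 0 < 'Re s \/ 0 < 'Re (- s).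
    case: sR => R0; [left|right]; first by rewrite lt_def ne.
    by rewrite raddfN oppr_gt0 lt_def eq_sym ne.
  - by have := match_gf_sqr_neq0 V R0; rewrite zE Mz eqxx.
  - by have := match_gf_sqr_neq0 V R0; rewrite sqrrN zE Mz eqxx.
rewrite -zE (Crect s) Re0 add0r exprMn sqrCi mulN1r oppr_le0.
by rewrite -realEsqr Creal_Im.
Qed.

End HalfPlane.

(** * From nonpositive roots to log-concave coefficients *)

(** Multiplication by ['X + b] acts in this way on coefficients, up to an index shift. The
    difference of the two sides is a polynomial in [b] with nonnegative coefficients. *)
Lemma log_concave_shift (K : numDomainType) (b : K) (c : nat -> K) :
  0 <= b ->
  (forall i, 0 <= c i) ->
  (forall i j, (i <= j)%N -> c i * c j.+1 <= c i.+1 * c j) ->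
  forall i j, (i <= j)%N ->
    (b * c i.+1 + c i) * (b * c j.+2 + c j.+1) <=
    (b * c i.+2 + c i.+1) * (b * c j.+1 + c j).
Proof.
move=> b0 c0 cc i j ij; rewrite -subr_ge0.
have -> : (b * c i.+2 + c i.+1) * (b * c j.+1 + c j) -
   (b * c i.+1 + c i) * (b * c j.+2 + c j.+1) =
   b ^+ 2 * (c i.+2 * c j.+1 - c i.+1 * c j.+2) +
   (b * (c i.+2 * c j - c i * c j.+2) + (c i.+1 * c j - c i * c j.+1)) by ring.
rewrite addr_ge0 ?mulr_ge0 ?exprn_ge0 ?subr_ge0 ?cc // addr_ge0 ?mulr_ge0 ?subr_ge0 ?cc //.
(* For [i < j] the linear coefficient takes two applications, passing through [c i.+1 * c j.+1]. *)
move: ij; rewrite leq_eqVlt => /orP[/eqP ->|ij]; first by rewrite mulrC.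
by apply: le_trans (cc _ _ ij); apply: cc; apply: leqW; apply: ltnW.
Qed.

(** Factors are added one at a time. The inequality for all [i <= j], which is stronger than the one
    for neighbours when coefficients may vanish, is what the induction preserves. *)
Lemma log_concave_prod (K : numFieldType) (r : seq K) :
  (forall z, z \in r -> z <= 0) ->
  let p := \prod_(z <- r) ('X - z%:P) in
  (forall i, 0 <= p`_i) /\
  (forall i j, (i <= j)%N -> p`_i * p`_j.+1 <= p`_i.+1 * p`_j).
Proof.
elim: r => [|z r IHr] rz /=.
  rewrite big_nil; split=> [i|i j _]; rewrite !coef1 ?ler0n //=.
  by rewrite mulr0 mul0r.
have z0 : 0 <= - z by rewrite oppr_ge0 rz ?mem_head.
have [|p0 pp] := IHr; first by move=> y yr; rewrite rz // in_cons yr orbT.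
rewrite big_cons; set p := \prod_(_ <- _) _ in p0 pp *.
pose c i := ('X * p)`_i.
have cE i : (('X - z%:P) * p)`_i = - z * c i.+1 + c i.
  by rewrite mulrBl coefB coefCM /c !coefXM /= mulNr addrC.
have c0 i : 0 <= c i by rewrite /c coefXM; case: eqP.
split=> [i|i j ij]; first by rewrite cE addr_ge0 ?mulr_ge0.
rewrite !cE; apply: log_concave_shift => // {ij} {}i {}j ij; rewrite /c !coefXM /=.
case: i ij => [|i] ij; first by rewrite mul0r mulr_ge0 //; case: eqP.
by case: j ij => // j ij /=; apply: pp.
Qed.

(** Over [algC] the generating polynomial splits with nonpositive roots; its leading coefficient
    contributes a nonnegative square to both sides. *)
Lemma mk_log_concave i j : (i <= j)%N ->
  (mk e i * mk e j.+1 <= mk e i.+1 * mk e j)%N.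
Proof.
move=> ij; pose p : {poly algC} := \poly_(k < #|T|.+1) (mk e k)%:R.
have pE k : p`_k = (mk e k)%:R.
  rewrite coef_poly; case: ltnP => // kT; rewrite /mk (_ : [set S | _] = set0) ?cards0 //.
  apply/setP => S; rewrite !inE; apply/negP => /andP[mS /eqP cS].
  by have := card_matching_le mS; rewrite cS leqNgt kT.
have [r pr] := closed_field_poly_normal p.
have rz z : z \in r -> z <= 0.
  move=> zr; apply: (@match_gf_root_le0 _ z [set: T]); rewrite match_gfE.
  have : p.[z] = 0.
    by rewrite pr hornerZ (rootP _) ?mulr0 // root_prod_XsubC.
  by rewrite horner_poly.
have [q0 qq] := log_concave_prod rz.
rewrite -(ler_nat algC) !natrM -!pE pr !coefZ.
rewrite mulrACA [leRHS]mulrACA ler_wpM2l ?qq //.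
by rewrite mulr_ge0 // lead_coefE pE ler0n.
Qed.

End Matchings.

(** * Disjoint copies *)

Section Copies.
Variables (T : finType) (e : rel T) (N : nat).
Hypothesis he : simple_graph e.

Definition copies : rel (T * 'I_N) := fun a b => e a.1 b.1 && (a.2 == b.2).

Lemma copies_simple : simple_graph copies.
Proof.
have [esym eirr] := he; split=> [a b|a]; rewrite /copies.
  by rewrite esym eq_sym.
by rewrite eirr.
Qed.

Lemma copies_regular d : regular e d -> regular copies d.
Proof.
move=> er [x i]; rewrite -(er x).
rewrite -(card_imset (f := fun y : T => (y, i)) [set y | e x y]); last by move=> y z [].
apply: eq_card => -[y j]; rewrite inE /copies /=; apply/andP/imsetP.
  by move=> [exy /eqP <-]; exists y; rewrite ?inE.
by move=> [z]; rewrite inE => exz [-> ->].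
Qed.

Lemma copies_bipartite : bipartite e -> bipartite copies.
Proof.
move=> [A eA]; exists [set a | a.1 \in A] => a b /andP[/eA ab _].
by rewrite !inE.
Qed.

(** [h] places a vertex set in one layer, and [fiber] reads off each layer of an edge set. They
    embed the matchings of the copies into [N]-tuples of matchings of [e]. *)
Let h (q : {set T} * 'I_N) : {set T * 'I_N} := [set (x, q.2) | x in q.1].

Let fiber (S : {set {set T * 'I_N}}) : {ffun 'I_N -> {set {set T}}} :=
  [ffun i => [set E | h (E, i) \in S]].

Let mem_h q x i : ((x, i) \in h q) = (x \in q.1) && (i == q.2).
Proof.
apply/imsetP/andP => [[y yq [-> ->]]|[xq /eqP ->]]; first by rewrite yq eqxx.
by exists x.
Qed.

Let edge_h E : E \in edges copies -> exists2 q, E = h q & q.1 \in edges e.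
Proof.
move=> /edgesP[[x i] [[y j] [/andP[/= exy /eqP ij] ->]]]; subst j.
exists ([set x; y], i); last by apply/edgesP; exists x, y.
apply/setP => -[z k]; rewrite mem_h !inE /= !xpair_eqE.
by case: (k == i); rewrite ?andbT ?andbF.
Qed.

Let h_edge q : h q \in edges copies -> q.1 \in edges e.
Proof.
move=> /edgesP[[x i] [[y j] [/andP[/= exy /eqP ij] E]]]; subst j.
apply/edgesP; exists x, y; split=> //; apply/setP => z.
have iq : i == q.2.
  have : (x, i) \in h q by rewrite E set21.
  by rewrite mem_h => /andP[].
have := mem_h q z i; rewrite E iq andbT => <-.
by rewrite !inE !xpair_eqE eqxx !andbT.
Qed.

(** The edge hypothesis excludes the empty set, whose image under [h] forgets the layer. *)
Let h_inj q q' : h q \in edges copies -> h q = h q' -> q = q'.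
Proof.
move=> /h_edge/edgesP[x [y [exy qE]]] hq.
have : (x, q.2) \in h q by rewrite mem_h qE !inE !eqxx.
rewrite hq mem_h => /andP[_ /eqP q2].
have q1 : q.1 = q'.1.
  apply/setP => z; have := mem_h q z q.2; rewrite eqxx andbT => <-.
  by rewrite hq mem_h q2 eqxx andbT.
by case: q q' q1 q2 {hq qE} => [? ?] [? ?] /= -> ->.
Qed.

Let imset_h S : matching copies S ->
  h @: [set q | q.1 \in fiber S q.2] = S.
Proof.
move=> /matchingP[/subsetP Se _]; apply/setP => E; apply/imsetP/idP.
  by move=> [[F i]]; rewrite inE ffunE inE => ? ->.
by move=> ES; have [[F i] EE _] := edge_h (Se _ ES); exists (F, i); rewrite // inE ffunE inE -EE.
Qed.

Let fiber_matching S i : matching copies S -> matching e (fiber S i).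
Proof.
move=> /matchingP[/subsetP Se Sd]; apply/matchingP; split.
  by apply/subsetP => E; rewrite ffunE inE => /Se/h_edge.
move=> E1 E2 x; rewrite ffunE !inE => h1 h2 x1 x2.
suff : (E1, i) = (E2, i) by case.
apply: h_inj; first exact: Se.
by apply: (Sd _ _ (x, i)) => //; rewrite mem_h /= ?x1 ?x2 eqxx.
Qed.

Let card_fiber S : matching copies S -> (#|S| = \sum_i #|fiber S i|)%N.
Proof.
move=> mS; rewrite -{1}(imset_h mS) card_in_imset; last first.
  have /matchingP[/subsetP Se _] := mS.
  move=> [E i] q; rewrite inE ffunE inE => hS _; apply: h_inj; exact: Se.
rewrite -sum1dep_card -(pair_big_dep xpredT (fun E i => E \in fiber S i) (fun _ _ => 1%N)) /=.
by rewrite (exchange_big_dep xpredT) //=; apply: eq_bigr => i _; rewrite sum1_card.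
Qed.

Let fiber_inj : {in [pred S | matching copies S] &, injective fiber}.
Proof.
by move=> S S' mS mS' eqf; rewrite -(imset_h mS) -(imset_h mS') eqf.
Qed.

Lemma match_gf_copies_le (K : numDomainType) (t : K) : 0 <= t ->
  match_gf copies [set: _] t <= match_gf e [set: T] t ^+ N.
Proof.
move=> t0; rewrite /match_gf.
under eq_bigl do rewrite subsetT andbT.
under [X in _ <= X ^+ _]eq_bigl do rewrite subsetT andbT.
rewrite -[in leRHS](card_ord N) -prodr_const bigA_distr_big /=.
pose F (f : {ffun 'I_N -> {set {set T}}}) := \prod_i t ^+ #|f i|.
rewrite (eq_bigr (fun S => F (fiber S))) => [|S mS]; last first.
  by rewrite (card_fiber mS) /F prodrXr.
(* The expanded power sums over all tuples of matchings; tuples outside the image of [fiber]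
   contribute nonnegative terms. *)
rewrite -(big_imset F fiber_inj) /= big_mkcond [leRHS]big_mkcond /=.
apply: ler_sum => f _.
have F0 : 0 <= F f by apply: prodr_ge0 => i _; apply: exprn_ge0.
case: imsetP => [[S mS ->]|_]; last by case: ifP.
rewrite ifT //; apply/ffun_onP => i; exact: fiber_matching.
Qed.

End Copies.

(** * Positivity and vanishing of matching numbers *)

Section MatchingNumbers.
Variables (T : finType) (e : rel T).

Lemma mk_gt0P k :
  reflect (exists2 S, matching e S & #|S| = k) (0 < mk e k)%N.
Proof.
apply: (iffP card_gt0P) => [[S]|[S mS cS]].
  by rewrite inE => /andP[mS /eqP]; exists S.
by exists S; rewrite inE mS cS /=.
Qed.

Lemma mk0 : mk e 0 = 1%N.
Proof.
rewrite /mk (_ : [set S | _] = [set set0]) ?cards1 //.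
apply/setP => S; rewrite !inE cards_eq0 andbC.
by case: eqP => //= ->; rewrite matching0.
Qed.

Lemma mk_nu_gt0 : (0 < mk e (nu e))%N.
Proof.
apply/mk_gt0P; have [|S mS cS] := @eq_bigmax_cond _ [pred S | matching e S] (fun S => #|S|).
  by apply/card_gt0P; exists set0; rewrite inE matching0.
by exists S.
Qed.

(** Edges are removed one at a time from a maximum matching. *)
Lemma mk_gt0 k : (k <= nu e)%N -> (0 < mk e k)%N.
Proof.
move=> kn; rewrite -(subKn kn).
elim: (nu e - k)%N => [|i IHi]; first by rewrite subn0 mk_nu_gt0.
have [ie|ie] := leqP (nu e) i.
  by move: IHi; rewrite (eqP ie) subnS (eqP ie).
have /mk_gt0P[S mS cS] := IHi.
have /card_gt0P[E ES] : (0 < #|S|)%N by rewrite cS subn_gt0.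
apply/mk_gt0P; exists (S :\ E); first by apply: matching_sub mS; exact: subD1set.
by have := cardsD1 E S; rewrite ES cS subnS => ->.
Qed.

Lemma mk_eq0 k : (nu e < k)%N -> mk e k = 0%N.
Proof.
move=> kn; apply/eqP; rewrite -leqn0 leqNgt; apply/negP => /mk_gt0P[S mS cS].
move: kn; rewrite ltnNge -cS; apply/negP; rewrite negbK.
exact: (@leq_bigmax_cond _ [pred S | matching e S] (fun S => #|S|)).
Qed.

Lemma nu_le_card : (nu e <= #|T|)%N.
Proof.
have /mk_gt0P[S mS cS] := mk_nu_gt0.
rewrite -cS. exact: card_matching_le mS.
Qed.

Lemma nu_gt0 d : simple_graph e -> regular e d -> (0 < d)%N -> (0 < #|T|)%N ->
  (0 < nu e)%N.
Proof.
move=> he er d0 /card_gt0P[x _].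
have /card_gt0P[y] : (0 < #|[set y | e x y]|)%N by rewrite er.
rewrite inE => exy; rewrite ltnNge; apply/negP => nu0.
have : (0 < mk e 1)%N.
  apply/mk_gt0P; exists ([set x; y] |: set0); last by rewrite setU0 cards1.
  by apply: matching_setU1 => //; rewrite ?matching0 // /cover big_set0 inE.
by rewrite mk_eq0.
Qed.

End MatchingNumbers.

(** * Bounds on the generating polynomial *)

Section GeneratingPolynomial.
Variables (R : realDomainType) (T : finType) (e : rel T).

Lemma mk_le_match_gf (t : R) k : 0 <= t ->
  (mk e k)%:R * t ^+ k <= match_gf e [set: T] t.
Proof.
move=> t0; rewrite match_gfE; have [kT|kT] := leqP k #|T|; last first.
  rewrite mk_eq0 ?(leq_ltn_trans (nu_le_card e)) // mul0r sumr_ge0 // => i _.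
  by rewrite mulr_ge0 ?exprn_ge0.
rewrite (bigD1 (inord k)) //= inordK // lerDl sumr_ge0 // => i _.
by rewrite mulr_ge0 ?exprn_ge0.
Qed.

Lemma match_gf_ge1 (t : R) : 0 <= t -> 1 <= match_gf e [set: T] t.
Proof. by move=> t0; have := mk_le_match_gf 0 t0; rewrite mk0 mul1r. Qed.

Lemma match_gf_le_pow_nu (t : R) : 1 <= t ->
  match_gf e [set: T] t <= match_gf e [set: T] 1 * t ^+ nu e.
Proof.
move=> t1; rewrite !match_gfE mulr_suml; apply: ler_sum => k _.
rewrite expr1n mulr1; have [kn|kn] := leqP k (nu e).
  by rewrite ler_wpM2l // ler_weXn2l.
by rewrite mk_eq0 // !mul0r.
Qed.

(* At [t = m_(k-1) / m_k] the [k]-th term of the generating function is the largest one. *)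
Lemma match_gf_le_max_term (K : realFieldType) k : simple_graph e ->
  (0 < k <= nu e)%N ->
  exists2 t : K, 0 < t &
    match_gf e [set: T] t <= #|T|.+1%:R * ((mk e k)%:R * t ^+ k).
Proof.
case: k => // k he /andP[_ kn].
have m0 : 0 < (mk e k)%:R :> K by rewrite ltr0n mk_gt0 // ltnW.
have m1 : 0 < (mk e k.+1)%:R :> K by rewrite ltr0n mk_gt0.
pose t : K := (mk e k)%:R / (mk e k.+1)%:R.
have t0 : 0 < t by rewrite divr_gt0.
exists t => //.
pose a j : K := (mk e j)%:R * t ^+ j.
(* By log-concavity the ratios [a j.+1 / a j] decrease, and [t] makes the ratio equal to 1 at
   [j = k]. The index of the statement is now [k.+1]. *)
have up j : (j <= k)%N -> a j <= a j.+1.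
  move=> jk; rewrite /a exprS mulrA ler_wpM2r ?exprn_ge0 ?(ltW t0) //.
  by rewrite /t mulrA ler_pdivlMr // -!natrM ler_nat mk_log_concave.
have down j : (k.+1 <= j)%N -> a j.+1 <= a j.
  move=> kj; rewrite /a exprS mulrA ler_wpM2r ?exprn_ge0 ?(ltW t0) //.
  rewrite /t mulrA ler_pdivrMr // -!natrM ler_nat mulnC [leqRHS]mulnC.
  by rewrite mk_log_concave // ltnW.
have amax j : a j <= a k.+1.
  have [jk|kj] := leqP j k.+1.
    have [i -> {jk}] : exists i, j = (k.+1 - i)%N by exists (k.+1 - j)%N; rewrite subKn.
    elim: i => [|i IHi]; first by rewrite subn0.
    have [ki|ik] := leqP k.+1 i.
      by move: IHi; rewrite subnS (eqP ki).
    apply: le_trans IHi; rewrite subnS -[in leRHS](prednK (n := k.+1 - i)) ?subn_gt0 //.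
    by apply: up; lia.
  rewrite -(subnK (ltnW kj)); elim: (j - k.+1)%N => [//|i IHi].
  by apply: le_trans IHi; rewrite addSn; apply: down; rewrite leq_addl.
rewrite match_gfE; apply: (@le_trans _ _ (\sum_(j < #|T|.+1) a k.+1)).
  by apply: ler_sum => j _; apply: amax.
by rewrite sumr_const card_ord mulr_natl.
Qed.

End GeneratingPolynomial.

(* Imported only here, because [classical_sets] shadows [finset]. *)
From mathcomp Require Import all_classical all_reals all_analysis.
Import numFieldNormedType.Exports.
Local Open Scope classical_set_scope.
Local Open Scope ring_scope.

(** * The entropy function as an infimum *)

Section FreeEnergy.
Variables (R : realType) (T : finType) (e : rel T).
Hypothesis T0 : (0 < #|T|)%N.
Implicit Types p s t a : R.

Local Notation M t := ((Mpoly R e).[t]).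
Local Notation v := (vG R T).
Local Notation nuR := ((nu e)%:R : R).

(** This is [f_t(p)], affine in [p] with slope [- ln t / 2]. *)
Definition free_energy t p : R := ln (M t) / v - 2^-1 * p * ln t.

Lemma MpolyE t : M t = match_gf e [set: T]%SET t.
Proof. by rewrite horner_poly match_gfE. Qed.

Lemma Mpoly_ge1 t : 0 <= t -> 1 <= M t.
Proof. by rewrite MpolyE; apply: match_gf_ge1. Qed.

Lemma Mpoly_gt0 t : 0 <= t -> 0 < M t.
Proof. by move=> /Mpoly_ge1; apply: lt_le_trans. Qed.

Lemma mulX_deriv_Mpoly t :
  t * ((Mpoly R e)^`()).[t] = \sum_(k < #|T|.+1) k%:R * ((mk e k)%:R * t ^+ k).
Proof.
rewrite /Mpoly poly_def raddf_sum horner_sum mulr_sumr; apply: eq_bigr => -[[|k] kT] _ /=.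
  by rewrite expr0 derivZ derivC scaler0 horner0 mulr0 mul0r.
rewrite derivZ derivXn hornerZ hornerMn hornerXn -mulr_natr exprS /=; ring.
Qed.

Let v_gt0 : 0 < v. Proof. by rewrite ltr0n. Qed.

Lemma half_pstar_v p : p <= pstar R e -> 2^-1 * p * v <= nuR.
Proof.
rewrite /pstar ler_pdivlMr // => pv.
lra.
Qed.

(** For [t >= 1], a maximum matching gives [M t >= t ^ nu], and [p v / 2 <= nu]. For [t < 1] both
    summands are nonnegative. *)
Lemma free_energy_ge0 t p : 0 < t -> 0 <= p <= pstar R e -> 0 <= free_energy t p.
Proof.
move=> t0 /andP[p0 pp]; have h := half_pstar_v pp.
rewrite subr_ge0 ler_pdivlMr // mulrAC.
have [t1|t1] := leP 1 t.
  have l0 := ln_ge0 t1; apply: (le_trans (ler_wpM2r l0 h)).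
  rewrite mulrC mulr_natr -lnXn // ler_ln ?posrE ?exprn_gt0 ?Mpoly_gt0 ?(ltW t0) //.
  rewrite MpolyE; apply: le_trans (mk_le_match_gf e (nu e) (ltW t0)).
  by rewrite ler_peMl ?exprn_ge0 ?(ltW t0) // ler1n mk_nu_gt0.
apply: (@le_trans _ _ 0); last by rewrite ln_ge0 // Mpoly_ge1 // ltW.
rewrite mulr_ge0_le0 ?ln_le0 ?(ltW t1) // !mulr_ge0 //; exact: ltW.
Qed.

(* Jensen's inequality for the random size [K] of a matching drawn with weights [t ^ |S|]:
   [M s / M t = E ((s/t)^K) >= (s/t)^(E K)] and [E K = v p(G,t) / 2]. *)
Lemma free_energy_pG_min t s : 0 < t -> 0 < s ->
  free_energy t (pG e t) <= free_energy s (pG e t).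
Proof.
move=> t0 s0; set c := 2^-1 * pG e t * v.
have Mt := Mpoly_gt0 (ltW t0); have Ms := Mpoly_gt0 (ltW s0).
have cE : c * M t = t * ((Mpoly R e)^`()).[t].
  by rewrite /c /pG; field; rewrite !gt_eqF.
have fE u : free_energy u (pG e t) = (ln (M u) - c * ln u) / v.
  by rewrite /free_energy /c; field; rewrite gt_eqF.
rewrite !fE ler_pM2r ?invr_gt0 //.
pose L := ln s - ln t.
suff : c * L + ln (M t) <= ln (M s) by rewrite /L; lra.
rewrite -ler_expR expRD !lnK ?posrE //.
(* The linear corrections sum to zero because [c] is the mean matching size at weight [t]; then
   [1 + x <= expR x] is applied termwise. *)
have -> : expR (c * L) * M t = expR (c * L) *
    \sum_(k < #|T|.+1) ((mk e k)%:R * t ^+ k) * (1 + (k%:R - c) * L).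
  congr (_ * _); transitivity (\sum_(k < #|T|.+1) (mk e k)%:R * t ^+ k +
    (\sum_(k < #|T|.+1) k%:R * ((mk e k)%:R * t ^+ k) -
     c * \sum_(k < #|T|.+1) (mk e k)%:R * t ^+ k) * L); last first.
    by rewrite mulr_sumr -sumrB mulr_suml -big_split; apply: eq_bigr => k _ /=; ring.
  by rewrite -mulX_deriv_Mpoly -cE -match_gfE -MpolyE subrr mul0r addr0.
rewrite [leRHS]MpolyE match_gfE mulr_sumr; apply: ler_sum => k _.
have -> : s ^+ k = expR (c * L) * (t ^+ k * expR ((k%:R - c) * L)).
  rewrite -(lnK (x := t ^+ k)) ?posrE ?exprn_gt0 // lnXn // -!expRD.
  rewrite -[LHS](lnK (x := s ^+ k)) ?posrE ?exprn_gt0 // lnXn //; congr expR.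
  by rewrite -(mulr_natr (ln s)) -(mulr_natr (ln t)) /L; ring.
rewrite [leRHS]mulrCA ler_wpM2l ?expR_ge0 // mulrA.
rewrite ler_wpM2l ?expR_ge1Dx // mulr_ge0 ?ler0n // exprn_ge0 //; exact: ltW.
Qed.

(** The equation says that [q = t M' - c M] vanishes. This polynomial is negative at 0 and
    nonnegative at a large [b], since [c < nu]. *)
Lemma pG_surj p : 0 < p < pstar R e -> exists2 t, 0 < t & pG e t = p.
Proof.
move=> /andP[p0 pp]; set c := 2^-1 * p * v.
have c0 : 0 < c by rewrite !mulr_gt0 // invr_gt0.
have cn : c < nuR.
  by move: pp; rewrite /pstar ltr_pdivlMr // /c => pp; lra.
pose q := 'X * (Mpoly R e)^`() - c *: Mpoly R e.
have qE t : q.[t] = \sum_(k < #|T|.+1) (k%:R - c) * ((mk e k)%:R * t ^+ k).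
  rewrite /q hornerD hornerN hornerM hornerX hornerZ mulX_deriv_Mpoly MpolyE match_gfE.
  by rewrite mulr_sumr -sumrB; apply: eq_bigr => k _; ring.
(* Chosen so that [(nuR - c) * b - c * M 1 = nuR - c]. *)
pose b := 1 + c * M 1 / (nuR - c).
have M1 := Mpoly_gt0 ler01.
have b1 : 1 <= b by rewrite lerDl divr_ge0 // ?subr_ge0 ?mulr_ge0 // ltW.
have b0 : 0 < b by apply: lt_le_trans b1.
have nu0 : (0 < nu e)%N by rewrite -(ltr0n R); apply: lt_trans cn.
have qb : 0 <= q.[b].
  pose B := b ^+ (nu e).-1.
  have B0 : 0 <= B by rewrite exprn_ge0 // ltW.
  (* The top term gains at least [(nuR - c) * b ^ nu], and all losses together are at most
     [c * M 1 * b ^ (nu - 1)]. *)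
  have term (k : 'I_#|T|.+1) : (if (k : nat) == nu e then (nuR - c) * (b * B) else 0) -
      c * (mk e k)%:R * B <= (k%:R - c) * ((mk e k)%:R * b ^+ k).
    have m0 : 0 <= (mk e k)%:R :> R by [].
    have bk : 0 <= b ^+ k by rewrite exprn_ge0 // ltW.
    case: eqP => [kn|/eqP kn].
      have -> : b ^+ k = b * B by rewrite /B -exprS prednK // kn.
      have m1 : 1 <= (mk e k)%:R :> R by rewrite ler1n kn mk_nu_gt0.
      have : 0 <= (nuR - c) * ((mk e k)%:R - 1) * (b * B).
        by rewrite !mulr_ge0 ?subr_ge0 // ltW.
      have : 0 <= c * (mk e k)%:R * B by rewrite !mulr_ge0 // ltW.
      by rewrite kn; lra.
    have [kl|kg] := ltnP k (nu e); last first.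
      by rewrite mk_eq0 ?ltn_neqAle 1?eq_sym ?kn // mulr0 !mul0r !mulr0 subr0.
    have kB : b ^+ k <= B by apply: ler_weXn2l => //; rewrite -ltnS prednK.
    have : 0 <= c * (mk e k)%:R * (B - b ^+ k).
      by rewrite !mulr_ge0 ?subr_ge0 // ltW.
    have : 0 <= k%:R * ((mk e k)%:R * b ^+ k) by rewrite !mulr_ge0.
    by lra.
  rewrite qE; apply: le_trans (ler_sum _ (fun k _ => term k)).
  rewrite sumrB -big_mkcond /= (big_pred1 (inord (nu e))) => [|k]; last first.
    have nT : (nu e < #|T|.+1)%N by rewrite ltnS nu_le_card.
    by apply/eqP/eqP => [kn|->]; [apply/val_inj; rewrite /= inordK|rewrite inordK].
  rewrite -mulr_suml -mulr_sumr.
  have -> : \sum_(k < #|T|.+1) (mk e k)%:R = M 1.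
    by rewrite MpolyE match_gfE; apply: eq_bigr => k _; rewrite expr1n mulr1.
  have -> : (nuR - c) * (b * B) - c * M 1 * B = (nuR - c) * B.
    by rewrite /b; field; rewrite gt_eqF // subr_gt0.
  by rewrite mulr_ge0 // subr_ge0 ltW.
have q0 : q.[0] < 0.
  rewrite /q hornerD hornerN hornerM hornerX hornerZ mul0r add0r oppr_lt0.
  by rewrite mulr_gt0 // Mpoly_gt0.
have [|t /andP[t0 tb] /rootP qt] := @poly_ivt R q 0 b (ltW b0).
  by rewrite (ltW q0).
have tN0 : t != 0 by apply/eqP => tE; rewrite tE in qt; rewrite qt ltxx in q0.
exists t; first by rewrite lt_def tN0.
have Mt := Mpoly_gt0 t0.
move: qt; rewrite /q hornerD hornerN hornerM hornerX hornerZ => /eqP.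
rewrite subr_eq0 => /eqP qt.
rewrite /pG -(mulrA 2) qt /c; field.
by rewrite !gt_eqF.
Qed.

Lemma lambda0E p : 0 < p < pstar R e ->
  exists t, [/\ 0 < t, pG e t = p & lambda0 e p = free_energy t p].
Proof.
move=> pp; have [t t0 tp] := pG_surj pp; exists (tG e p).
(* A solution exists, so the default of [xget] does not occur; the chosen one is nonzero because
   [pG e 0 = 0 < p]. *)
have [/= tg0 tgp] : [set t | 0 <= t /\ pG e t = p] (tG e p).
  by apply: (xgetPex 0); exists t; split=> //; apply: ltW.
have /andP[p0 _] := pp.
split=> //; last by rewrite /lambda0 gt_eqF.
rewrite lt_neqAle tg0 andbT; apply/eqP => tgE.
by move: p0; rewrite -tgp -tgE /pG mulr0 !mul0r ltxx.
Qed.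

Lemma lambda0_le p s : 0 <= p < pstar R e -> 0 < s -> lambda0 e p <= free_energy s p.
Proof.
move=> /andP[p0 pp] s0; case: (eqVneq p 0) => [pE|pN0].
  by rewrite /lambda0 pE eqxx free_energy_ge0 // lexx -pE ltW.
have [|t [t0 tp ->]] := @lambda0E p; first by rewrite lt_def pN0 p0.
by have := free_energy_pG_min t0 s0; rewrite tp.
Qed.

(** Adding the minimality of the weights 1 and [t] at their own densities gives
    [0 <= (p - pG e 1) * ln t]. *)
Lemma lambda0E_large p : Num.max 0 (pG e 1) < p < pstar R e ->
  exists t, [/\ 1 <= t, pG e t = p & lambda0 e p = free_energy t p].
Proof.
move=> /andP[]; rewrite gt_max => /andP[p0 p1] pp.
have [|t [t0 tp lE]] := @lambda0E p; first by rewrite p0.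
exists t; split=> //.
have h1 := free_energy_pG_min ltr01 t0; have h2 := free_energy_pG_min t0 ltr01.
rewrite tp /free_energy ln1 in h1 h2.
rewrite -ler_ln ?posrE // ln1.
have : 0 <= (p - pG e 1) * ln t by lra.
by rewrite pmulr_rge0 // subr_gt0.
Qed.

Lemma free_energy_nonincreasing t p q : 1 <= t -> p <= q ->
  free_energy t q <= free_energy t p.
Proof.
move=> /ln_ge0 l0 pq; rewrite /free_energy lerD2l lerN2 ler_wpM2r // ler_pM2l //.
Qed.

Lemma near_left_pstar (P : R -> Prop) : Num.max 0 (pG e 1) < pstar R e ->
  (forall p, Num.max 0 (pG e 1) < p < pstar R e -> P p) ->
  \forall p \near (pstar R e)^'-, P p.
Proof.
move=> lt H; near=> p; apply: H; apply/andP; split; near: p.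
- by apply: nbhs_left_gt.
- by apply: nbhs_left_lt.
Unshelve. all: by end_near. Qed.

(** The empty matching has positive weight, so the mean size at weight 1 is strictly below [nu]. *)
Lemma pG_lt_pstar : (0 < nu e)%N -> Num.max 0 (pG e 1) < pstar R e.
Proof.
move=> nu0; have pst : 0 < pstar R e by rewrite /pstar divr_gt0 // mulr_gt0 // ltr0n.
rewrite gt_max pst /=.
have M1 := Mpoly_gt0 ler01.
rewrite /pG /pstar ltr_pdivrMr ?mulr_gt0 //.
have -> : 2 * nuR / v * (v * M 1) = 2 * (nuR * M 1) by field; rewrite gt_eqF.
rewrite -mulrA ltr_pM2l // mulX_deriv_Mpoly MpolyE match_gfE mulr_sumr -subr_gt0 -sumrB.
rewrite (bigD1 ord0) //= ltr_pwDl //.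
  by rewrite mk0 expr0 mul0r subr0 !mulr1 ltr0n.
apply: sumr_ge0 => k _; rewrite -mulrBl expr1n mulr1.
have [kn|kn] := leqP k (nu e); last by rewrite mk_eq0 // mulr0.
by rewrite mulr_ge0 // subr_ge0 ler_nat.
Qed.

(** Near [pstar] the function is nonnegative and nonincreasing: if [t >= 1] is optimal at [p <= q],
    then [lambda0 q <= f_t(q) <= f_t(p) = lambda0 p]. *)
Lemma cvg_lambda0 : (0 < nu e)%N -> cvg (lambda0 e p @[p --> (pstar R e)^'-]).
Proof.
move=> nu0; have lt := pG_lt_pstar nu0.
have -> : lambda0 e = (fun p => - (- lambda0 e p)).
  by apply/funext => p; rewrite opprK.
apply: is_cvgN; apply: nondecreasing_at_left_is_cvgr.
  apply: near_left_pstar => // x /andP[x0 xp] p q.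
  rewrite !in_itv /= => /andP[xp' pp] /andP[xq qq] pq; rewrite lerN2.
  have [|t [t1 tp ->]] := @lambda0E_large p; first by rewrite pp (lt_trans x0).
  apply: le_trans (free_energy_nonincreasing t1 pq).
  apply: lambda0_le; last exact: lt_le_trans t1.
  rewrite qq andbT ltW // (lt_trans _ xq) // (le_lt_trans _ x0) //.
  by rewrite le_max lexx.
apply: near_left_pstar => // x /andP[x0 xp]; exists 0 => _ [y /= + <-].
rewrite in_itv /= oppr_le0 => /andP[xy yp].
have [|t [t1 tp ->]] := @lambda0E_large y; first by rewrite yp (lt_trans x0).
apply: free_energy_ge0; first exact: lt_le_trans t1.
rewrite (ltW yp) andbT ltW // (lt_trans _ xy) // (le_lt_trans _ x0) //.
by rewrite le_max lexx.
Qed.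

Lemma lambdaG_le p s : (0 < nu e)%N -> 0 <= p <= pstar R e -> 0 < s ->
  lambdaG e p <= free_energy s p.
Proof.
move=> nu0 /andP[p0 pp] s0; rewrite /lambdaG; case: ltP => pp'.
  by apply: lambda0_le; rewrite ?p0.
have -> : p = pstar R e by apply/eqP; rewrite eq_le pp pp'.
rewrite eqxx; apply: (@ler_cvg_to _ (pstar R e)^'- _ _ (lambda0 e) (free_energy s)).
- exact: cvg_lambda0.
- apply: cvg_at_left_filter.
  rewrite /free_energy; apply: cvgB; first exact: cvg_cst.
  by apply: cvgM; [apply: cvgM; [exact: cvg_cst|exact: cvg_id] | exact: cvg_cst].
- apply: near_left_pstar; first exact: pG_lt_pstar.
  move=> q /andP[]; rewrite gt_max => /andP[q0 _] qp.
  by apply: lambda0_le; rewrite ?(ltW q0).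
Qed.

(** Below [pstar] the infimum is attained. At [pstar], the optimal [t >= 1] of a smaller [q] gives
    [a <= f_t(p) <= f_t(q) = lambda0 q], and [q] tends to [pstar]. *)
Lemma lambdaG_ge p a : (0 < nu e)%N -> 0 < p <= pstar R e ->
  (forall s, 0 < s -> a <= free_energy s p) -> a <= lambdaG e p.
Proof.
move=> nu0 /andP[p0 pp] H; rewrite /lambdaG; case: ltP => pp'.
  by have [|t [t0 _ ->]] := @lambda0E p; rewrite ?p0 // H.
have pE : p = pstar R e by apply/eqP; rewrite eq_le pp pp'.
rewrite pE eqxx; apply: limr_ge; first exact: cvg_lambda0.
apply: near_left_pstar; first exact: pG_lt_pstar.
move=> q qq; have [t [t1 _ ->]] := lambda0E_large qq.
apply: le_trans (H t _) _; first exact: lt_le_trans t1.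
by apply: free_energy_nonincreasing => //; rewrite pE; case/andP: qq => _ /ltW.
Qed.

Lemma lambdaG_0 p : pstar R e < p -> lambdaG e p = 0.
Proof. by move=> pp; rewrite /lambdaG ltNge ltW // gt_eqF. Qed.

Lemma free_energy_le0 p : pstar R e < p -> exists2 t, 0 < t & free_energy t p <= 0.
Proof.
move=> pp; have M1 := Mpoly_gt0 ler01.
(* The value of [ln t] at which [(p / 2) v ln t] catches up with the bound [ln (M 1) + nu ln t]. *)
pose L := 2 * ln (M 1) / (v * (p - pstar R e)).
have M10 : 0 <= ln (M 1) by rewrite ln_ge0 ?Mpoly_ge1.
have L0 : 0 <= L by rewrite divr_ge0 ?mulr_ge0 ?subr_ge0 // ltW.
exists (expR L); first exact: expR_gt0.
have t1 : 1 <= expR L by rewrite -expR0 ler_expR.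
have tg0 := expR_gt0 L.
rewrite /free_energy expRK subr_le0.
have : ln (M (expR L)) <= ln (M 1) + nuR * L.
  apply: le_trans (_ : ln (M 1 * expR L ^+ nu e) <= _).
    rewrite ler_ln ?posrE ?mulr_gt0 ?exprn_gt0 ?Mpoly_gt0 ?(ltW tg0) //.
    by rewrite !MpolyE match_gf_le_pow_nu.
  by rewrite lnM ?posrE ?exprn_gt0 // lnXn // expRK mulr_natl.
move=> h; rewrite ler_pdivrMr //; apply: (le_trans h).
have -> : nuR = 2^-1 * pstar R e * v by rewrite /pstar; field; rewrite gt_eqF.
rewrite -subr_ge0.
have -> : 2^-1 * p * L * v - (ln (M 1) + 2^-1 * pstar R e * v * L) = 0; last by [].
by rewrite /L; field; rewrite !gt_eqF // subr_gt0.
Qed.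

End FreeEnergy.

(** * Continuity of the target function *)

Section LogContinuity.
Variable R : realType.

(* [ln] is [0] on nonpositive reals, so [x * ln x] is continuous on the whole line. *)
Lemma continuous_mulr_ln : continuous (fun x : R => x * ln x).
Proof.
move=> x; have [x0|x0] := leP x 0; last first.
  by apply: cvgM; [exact: cvg_id | exact: continuous_ln].
suff : y * ln y @[y --> x] --> (0 : R) by rewrite /continuous_at (ln0 x0) mulr0.
(* For [0 < y < 1], bounding [ln (1 / sqrt y)] by [1 / sqrt y] gives [|y ln y| <= 2 sqrt y]; the
   square root is 0 at nonpositive points. *)
apply: norm_cvg0; apply: (@squeeze_cvgr _ _ _ _ (fun=> 0) (fun x => 2 * Num.sqrt x)).
- near=> y; rewrite normr_ge0 /=.
  have y1 : y < 1 by near: y; apply: lt_nbhsl; apply: le_lt_trans x0 _.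
  have [y0|y0] := leP y 0; first by rewrite ln0 // mulr0 normr0 mulr_ge0 // sqrtr_ge0.
  have s0 : 0 < Num.sqrt y by rewrite sqrtr_gt0.
  have yE : Num.sqrt y ^+ 2 = y by rewrite sqr_sqrtr // ltW.
  have := @ln_sublinear R (Num.sqrt y)^-1.
  rewrite invr_gt0 s0 => /(_ isT); rewrite lnV ?posrE // => h.
  have lE : ln y = 2 * ln (Num.sqrt y) by rewrite -{1}yE lnXn // mulr_natl.
  have l0 : ln y <= 0 by rewrite ln_le0 // ltW.
  rewrite normrM (gtr0_norm y0) (ler0_norm l0) lE.
  have : Num.sqrt y ^+ 2 * (- ln (Num.sqrt y)) <= Num.sqrt y ^+ 2 * (Num.sqrt y)^-1.
    by rewrite ler_wpM2l ?exprn_ge0 ?ltW // ltW.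
  rewrite expr2 -[leRHS]mulrA divff ?gt_eqF // mulr1 -expr2 yE; lra.
- exact: cvg_cst.
- have : 2 * Num.sqrt y @[y --> x] --> 2 * Num.sqrt x.
    by apply: cvgM; [exact: cvg_cst | exact: sqrt_continuous].
  by rewrite (ler0_sqrtr x0) mulr0.
Unshelve. all: by end_near. Qed.

(** The error function for (ii) => (i). With [s = sqrt (n + 1)], the bound [ln s < s] gives
    [s ln (n + 1) <= 2 (n + 1) <= 4 n]. *)
Lemma cvg_ln_div : (fun n => ln n.+1%:R / n%:R : R) @ \oo --> (0 : R).
Proof.
apply: (@squeeze_cvgr _ _ _ _ (fun=> 0) (fun n => 4 * Num.sqrt (harmonic n))).
- near=> n; have n0 : (0 < n)%N by near: n; exists 1%N.
  have n0R : 0 < n%:R :> R by rewrite ltr0n.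
  rewrite divr_ge0 ?ln_ge0 ?ler1n //= ler_pdivrMr // sqrtrV //.
  set s := Num.sqrt _.
  have sE : s ^+ 2 = n.+1%:R by rewrite sqr_sqrtr.
  have s0 : 0 < s by rewrite sqrtr_gt0 ltr0n.
  rewrite -sE lnXn // -mulr_natl [leRHS]mulrAC ler_pdivlMr //.
  have := ln_sublinear s0; have := ler1n R n; rewrite n0 => n1 ls.
  have : s * ln s <= s * s by rewrite ler_pM2l // ltW.
  by move: sE; rewrite expr2 -natr1; lra.
- exact: cvg_cst.
- have : 4 * Num.sqrt (harmonic n) @[n --> \oo] --> 4 * Num.sqrt (0 : R).
    apply: cvgM; first exact: cvg_cst.
    apply: (@cvg_comp _ _ _ harmonic (@Num.sqrt R)); last exact: sqrt_continuous.
    exact: cvg_harmonic.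
  by rewrite sqrtr0 mulr0.
Unshelve. all: by end_near. Qed.

(** Splitting the logarithms leaves linear terms and terms [x ln x], so continuity reaches the
    endpoints. *)
Lemma GdE d (p : R) : 0 <= p <= 1 -> (0 < d)%N -> Gd d p =
  2^-1 * (p * ln d%:R - p * ln p + ((d%:R - p) * ln (d%:R - p) - (d%:R - p) * ln d%:R)
          - 2 * ((1 - p) * ln (1 - p))) :> R.
Proof.
move=> /andP[p0 p1] d0; have dR : 0 < d%:R :> R by rewrite ltr0n.
have d1 : 1 <= d%:R :> R by rewrite ler1n.
rewrite /Gd /mul_ln; congr (_ * (_ + _ - _)).
- case: eqP => [->|/eqP pN]; first by rewrite !mul0r subrr.
  have {}p0 : 0 < p by rewrite lt_def pN.
  by rewrite ln_div ?posrE // mulrBr.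
- case: eqP => [->|/eqP pN]; first by rewrite !mul0r subrr.
  have dp : 0 < d%:R - p by rewrite lt_def pN subr_ge0 (le_trans p1).
  have -> : 1 - p / d%:R = (d%:R - p) / d%:R by field; rewrite gt_eqF.
  by rewrite ln_div ?posrE // mulrBr.
- by case: eqP => [->|//]; rewrite !mul0r.
Qed.

Lemma Gd_cvg d (p : R) (q : nat -> R) : (0 < d)%N -> 0 <= p <= 1 ->
  (forall n, 0 <= q n <= 1) -> q @ \oo --> p -> (fun n => Gd d (q n)) @ \oo --> Gd d p.
Proof.
move=> d0 p01 q01 qp; rewrite GdE //.
under eq_fun do rewrite GdE //.
have K c : (fun n => (c - q n) * ln (c - q n)) @ \oo --> (c - p) * ln (c - p).
  apply: (@cvg_comp _ _ _ (fun n => c - q n) (fun x => x * ln x)); last exact: continuous_mulr_ln.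
  by apply: cvgB => //; exact: cvg_cst.
have K0 : (fun n => q n * ln (q n)) @ \oo --> p * ln p.
  by apply: (@cvg_comp _ _ _ q (fun x => x * ln x) _ _ _ qp); exact: continuous_mulr_ln.
apply: cvgM; first exact: cvg_cst.
apply: cvgB; last by apply: cvgM => //; exact: cvg_cst.
apply: cvgD.
  by apply: cvgB => //; apply: cvgM => //; exact: cvg_cst.
apply: cvgB => //; apply: cvgM; last exact: cvg_cst.
by apply: cvgB => //; exact: cvg_cst.
Qed.

Lemma Gd0 d : Gd d 0 = 0 :> R.
Proof.
by rewrite /Gd /mul_ln eqxx mul0r !subr0 ln1 !mulr0 !if_same !mulr0 !subr0 add0r mulr0.
Qed.

End LogContinuity.

(** * The two implications *)

Section Equivalence.
Variables (R : realType) (d : nat).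
Hypothesis d0 : (0 < d)%N.

(** One term [m_k t^k] is at most [M(G,t)^N]. The maximum with 0 covers [m_k = 0], where [ln 0] is
    0. *)
Lemma ln_mk_copies_le (T : finType) (e : rel T) (N k : nat) (t : R) :
  (0 < #|T|)%N -> (0 < N)%N -> 0 < t ->
  ln (mk (copies e (N := N)) k)%:R / (#|T| * N)%:R <=
  Num.max 0 (free_energy e t (2 * k%:R / (#|T| * N)%:R)).
Proof.
move=> T0 N0 t0; rewrite le_max.
case: (posnP (mk (copies e (N := N)) k)) => [->|m0].
  by rewrite ln0 // mul0r lexx.
apply/orP; right.
have Mt : 0 < (Mpoly R e).[t] by rewrite Mpoly_gt0 // ltW.
have m0R : 0 < (mk (copies e (N := N)) k)%:R :> R by rewrite ltr0n.
have := le_trans (mk_le_match_gf (copies e (N := N)) k (ltW t0))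
                 (match_gf_copies_le e N (ltW t0)).
rewrite -MpolyE -ler_ln ?posrE ?mulr_gt0 ?exprn_gt0 // lnM ?posrE ?exprn_gt0 // !lnXn //.
rewrite -(mulr_natr (ln t)) -(mulr_natr (ln _.[t])) => h.
rewrite /free_energy /vG natrM.
have T0R : 0 < #|T|%:R :> R by rewrite ltr0n.
have N0R : 0 < N%:R :> R by rewrite ltr0n.
rewrite ler_pdivrMr ?mulr_gt0 //.
have -> : (ln (Mpoly R e).[t] / #|T|%:R - 2^-1 * (2 * k%:R / (#|T|%:R * N%:R)) * ln t) *
  (#|T|%:R * N%:R) = ln (Mpoly R e).[t] * N%:R - ln t * k%:R.
  by field; rewrite !gt_eqF.
by rewrite lerBrDr.
Qed.

Lemma floor_ratio_cvg (a : nat) (p : R) : (0 < a)%N -> 0 <= p ->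
  (fun N => (Num.truncn (p * (a * N.+1)%:R))%:R / (a * N.+1)%:R) @ \oo --> p.
Proof.
move=> a0 p0; apply: (@squeeze_cvgr _ _ _ _ (fun N => p - harmonic N) (fun=> p)).
- near=> N; have aN : 0 < (a * N.+1)%:R :> R by rewrite ltr0n muln_gt0 a0.
  have /andP[h1 h2] := truncn_itv (mulr_ge0 p0 (ltW aN)).
  rewrite ler_pdivrMr // h1 andbT ler_pdivlMr // mulrBl.
  rewrite -natr1 in h2.
  suff : 1 <= harmonic N * (a * N.+1)%:R :> R by lra.
  by rewrite /harmonic natrM mulrCA mulVf ?mulr1 ?ler1n // pnatr_eq0.
- rewrite -[X in _ --> X]subr0; apply: cvgB; first exact: cvg_cst.
  exact: cvg_harmonic.
- exact: cvg_cst.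
Unshelve. all: by end_near. Qed.

Lemma Gd_le_free_energy (eps : nat -> R) : eps @ \oo --> (0 : R) ->
  (forall (T : finType) (e : rel T), simple_graph e -> regular e d ->
       bipartite e -> (0 < #|T|)%N ->
       forall n k : nat, #|T| = (2 * n)%N -> (k <= n)%N ->
         ln (mk e k)%:R / #|T|%:R >= Gd d (k%:R / n%:R) - eps #|T|) ->
  forall (T : finType) (e : rel T), simple_graph e -> regular e d ->
       bipartite e -> (0 < #|T|)%N -> forall p t : R, 0 <= p <= 1 -> 0 < t ->
  Gd d p <= Num.max 0 (free_energy e t p).
Proof.
move=> eps0 H T e he er eb T0 p t /[dup] p01 /andP[p0 p1] t0.
pose q N : R := (Num.truncn (p * (#|T| * N.+1)%:R))%:R / (#|T| * N.+1)%:R.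
have qp : q @ \oo --> p by apply: floor_ratio_cvg.
have TN N : 0 < (#|T| * N.+1)%:R :> R by rewrite ltr0n muln_gt0 T0.
have kle N : (Num.truncn (p * (#|T| * N.+1)%:R) <= #|T| * N.+1)%N.
  rewrite -(ler_nat R); have /andP[h _] := truncn_itv (mulr_ge0 p0 (ltW (TN N))).
  by apply: (le_trans h); rewrite ler_piMl // ltW.
have q01 N : 0 <= q N <= 1.
  by rewrite /q divr_ge0 //= ler_pdivrMr // mul1r ler_nat.
(* An even number of copies makes half the vertex count the integer [#|T| * N.+1], the denominator
   of [q N]. *)
have key N : Gd d (q N) - eps (#|T| * (2 * N.+1))%N <= Num.max 0 (free_energy e t (q N)).
  have cT : #|{: T * 'I_(2 * N.+1)}| = (#|T| * (2 * N.+1))%N by rewrite card_prod card_ord.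
  have := H _ _ (copies_simple (2 * N.+1) he) (copies_regular er) (copies_bipartite _ eb).
  rewrite cT => /(_ _ (#|T| * N.+1)%N _ _ (kle N)) h.
  apply: le_trans (h _ _) _; first by rewrite muln_gt0 T0.
    by rewrite mulnCA.
  apply: le_trans (ln_mk_copies_le _ _ _ _ t0) _ => //.
  by rewrite (_ : 2 * _ / _ = q N) // /q mulnCA (natrM _ 2) -mulf_div divff ?mul1r // pnatr_eq0.
apply: (@ler_cvg_to _ \oo _ _ (fun N => Gd d (q N) - eps (#|T| * (2 * N.+1))%N)
  (fun N => Num.max 0 (free_energy e t (q N)))).
- rewrite -[X in _ --> X]subr0; apply: cvgB; first exact: Gd_cvg.
  apply: (@cvg_comp _ _ _ (fun N => #|T| * (2 * N.+1))%N eps _ _ _ _ eps0).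
  apply/cvgnyPge => A; near=> N; have AN : (A <= N)%N by near: N; exact: nbhs_infty_ge.
  by apply: (leq_trans AN); nia.
- apply: (@cvg_comp _ _ _ q (fun x => Num.max 0 (free_energy e t x)) _ _ _ qp).
  apply: (@continuous_max R R (fun=> 0) (free_energy e t)); first exact: cvg_cst.
  apply: cvgB; first exact: cvg_cst.
  by apply: cvgM; [apply: cvgM; [exact: cvg_cst|exact: cvg_id] | exact: cvg_cst].
- exact: nearW.
Unshelve. all: by end_near. Qed.

End Equivalence.

Unset Implicit Arguments.

Theorem theorem3p1 (R : realType) (d : nat) (hd : (0 < d)%N) :
  (exists eps : nat -> R, eps @ \oo --> (0 : R) /\
     forall (T : finType) (e : rel T), simple_graph e -> regular e d ->
       bipartite e -> (0 < #|T|)%N ->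
       forall n k : nat, #|T| = (2 * n)%N -> (k <= n)%N ->
         ln (mk e k)%:R / #|T|%:R >= Gd d (k%:R / n%:R) - eps #|T|)
  <->
  (forall (T : finType) (e : rel T), simple_graph e -> regular e d ->
     bipartite e -> (0 < #|T|)%N ->
     forall p : R, 0 <= p <= 1 -> @lambdaG R T e p >= Gd d p).
Proof.
split=> [[eps [eps0 H]] T e he er eb T0 p p01 | H].
  have nu0 := nu_gt0 he er hd T0.
  have HG := Gd_le_free_energy hd eps0 H he er eb T0 p01.
  have [->|pN0] := eqVneq p 0.
    rewrite Gd0 /lambdaG /lambda0 eqxx ifT //.
    by rewrite /pstar divr_gt0 ?mulr_gt0 // ltr0n.
  have p0 : 0 < p by rewrite lt_def pN0; case/andP: p01.
  have [pp|pp] := leP p (pstar R e).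
    apply: lambdaG_ge => //; first by rewrite p0.
    move=> t t0; have := HG t t0; rewrite max_r // free_energy_ge0 //.
    by rewrite (ltW p0).
  (* At this weight the maximum is 0, which is the value of [lambdaG] here. *)
  rewrite lambdaG_0 //; have [t t0 f0] := free_energy_le0 T0 pp.
  by have := HG t t0; rewrite max_l.
exists (fun n => ln n.+1%:R / n%:R); split; first exact: cvg_ln_div.
move=> T e he er eb T0 n k Tn kn.
have T0R : 0 < #|T|%:R :> R by rewrite ltr0n.
have n0 : (0 < n)%N by rewrite Tn muln_gt0 in T0.
have n0R : 0 < n%:R :> R by rewrite ltr0n.
have eps_ge0 : 0 <= ln #|T|.+1%:R / #|T|%:R :> R by rewrite divr_ge0 ?ln_ge0 ?ler1n.
have nu0 := nu_gt0 he er hd T0.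
have [->|k0] := posnP k.
  by rewrite mk0 ln1 !mul0r Gd0 sub0r oppr_le0.
have p01 : 0 <= (k%:R / n%:R : R) <= 1.
  by rewrite divr_ge0 //= ler_pdivrMr // mul1r ler_nat.
have HG := H T e he er eb T0 _ p01.
have pstE : pstar R e = (nu e)%:R / n%:R.
  by rewrite /pstar /vG Tn natrM; field; rewrite gt_eqF.
(* Beyond [nu] both [ln (mk e k)] and [lambdaG] take the default value 0. *)
have [knu|knu] := leqP k (nu e); last first.
  rewrite mk_eq0 // [ln 0%:R]ln0 // mul0r lerBlDr add0r; apply: le_trans HG _.
  by rewrite lambdaG_0 // pstE ltr_pM2r ?invr_gt0 // ltr_nat.
have [|t t0 Mle] := @match_gf_le_max_term T e R k he; first by rewrite k0.
rewrite lerBlDr; apply: (le_trans HG); apply: (le_trans (lambdaG_le _ _ _ t0)) => //.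
  by case/andP: p01 => -> _; rewrite pstE ler_pM2r ?invr_gt0 // ler_nat.
have m0 : 0 < (mk e k)%:R :> R by rewrite ltr0n mk_gt0.
rewrite -MpolyE -ler_ln ?posrE ?mulr_gt0 ?exprn_gt0 ?Mpoly_gt0 // ?(ltW t0) // in Mle.
rewrite !lnM ?posrE ?mulr_gt0 ?exprn_gt0 // lnXn // -(mulr_natr (ln t)) in Mle.
rewrite /free_energy /vG -mulrDl lerBlDr.
have -> : 2^-1 * (k%:R / n%:R) * ln t = (ln t * k%:R) / #|T|%:R.
  by rewrite Tn natrM; field; rewrite gt_eqF.
by rewrite -mulrDl ler_pM2r ?invr_gt0 //; lra.
Qed.
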